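(* Both Scheme I and Scheme II conserve mass: if $(c^{\ell,n+1}_i,\psi^{n+1}_i)$ is a solution of Scheme I, or of Scheme II, at time step $n+1$ with data at step $n$ (and step $n-1$ for the extrapolation in Scheme II), then $$\sum_{i=1}^N \mathrm{m}(V_i)\,c^{\ell,n+1}_i=\sum_{i=1}^N \mathrm{m}(V_i)\,c^{\ell,n}_i\qquad\text{for } \ell=1,2,\dots,M .$$
   Context: Mesh: $\Omega\subset\mathbb{R}^d$ ($d=2,3$) is a bounded polygonal/polyhedral domain, $\partial\Omega=\Gamma_{\rm D}\cup\Gamma_{\rm N}$ (disjoint union). $\mathbf{x}_1,\dots,\mathbf{x}_N$ are the vertices of a Delaunay mesh (triangles/tetrahedra), and $V_i=\{\mathbf{y}\in\Omega: |\mathbf{x}_i-\mathbf{y}|<|\mathbf{x}_j-\mathbf{y}|\ \forall j\ne i\}$ are the dual Voronoi control volumes. $\mathrm{m}(\cdot)$ is Lebesgue measure in $\mathbb{R}^d$ or $\mathbb{R}^{d-1}$. Edges (faces): interior ones $\mathcal{E}_{int}$ are $\sigma=\partial V_i\cap\partial V_j$; exterior ones are $\mathcal{E}^{\rm D}_{ext}$ ($\sigma=\partial V_i\cap\Gamma_{\rm D}$) and $\mathcal{E}^{\rm N}_{ext}$ ($\sigma=\partial V_i\cap\Gamma_{\rm N}$). $\mathcal{E}_i$ is the set of edges of $V_i$. $d_\sigma=|\mathbf{x}_i-\mathbf{x}_j|$ for $\sigma=\partial V_i\cap\partial V_j$ interior, $d_\sigma=\mathrm{dist}(\mathbf{x}_i,\sigma)$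 for $\sigma\in\mathcal{E}_i$ exterior, and there is $\xi>0$ with $\mathrm{dist}(\mathbf{x}_i,\sigma)\ge\xi\,\mathrm{diam}(V_i)$ for all $\sigma\in\mathcal{E}_i$. $\tau_\sigma=\mathrm{m}(\sigma)/d_\sigma$. For interior $\sigma=\partial V_i\cap\partial V_j$, $Du_{i,\sigma}=u_j-u_i$. Parameters: real valences $z^\ell$, sizes $a_\ell>0$ ($\ell=1,\dots,M$), solvent size $a_0>0$, $\kappa,\chi,\gamma_\ell>0$, dielectric values $\varepsilon_i,\varepsilon_\sigma\in[\varepsilon_{\min},\varepsilon_{\max}]$ with $\varepsilon_{\min}>0$, fixed charges $\rho^f_i\in\mathbb{R}$, time step $\Delta t>0$. Write $S^n_i=1-\sum_{k=1}^M a_k^3c^{k,n}_i$. Boundary data (time independent): $\psi^{\rm D}_\sigma$, $\psi^{\rm N}_\sigma\in\mathbb{R}$; $D\psi_{i,\sigma}=\psi^{\rm D}_\sigma-\psi_i$ for $\sigma\in\mathcal{E}_i\cap\mathcal{E}^{\rm D}_{ext}$, and $\kappa\varepsilon_\sigma D\psi_{i,\sigma}/d_\sigma=\psi^{\rm N}_\sigma$ for $\sigma\in\mathcal{E}_i\cap\mathcal{E}^{\rm N}_{ext}$. Zero-flux condition: on every exterior edge, the product (mobility)$\times D\mu^\ell_{i,\sigma}$ appearing in the schemes is $0$. Nodal chemical potential: $\mu^{\ell,n}_i=z^\ell\psi^n_i+\log(a_\ell^3c^{\ell,n}_i)-\frac{a_\ell^3}{a_0^3}\log S^n_i+\frac{\chi(z^\ell)^2}{a_\ell}\left(\frac1{\varepsilon_i}-1\right)$.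 Discrete Poisson equation (at each step $n$): $-\kappa\sum_{\sigma\in\mathcal{E}_i}\tau_\sigma\varepsilon_\sigma D\psi^{n}_{i,\sigma}=\mathrm{m}(V_i)\left(\sum_{\ell=1}^M z^\ell c^{\ell,n}_i+\rho^f_i\right)$ for all $i$. Scheme I: discrete Poisson equation at step $n+1$ together with $$\mathrm{m}(V_i)\frac{c^{\ell,n+1}_i-c^{\ell,n}_i}{\Delta t}=\gamma_\ell\sum_{\sigma\in\mathcal{E}_i}\tau_\sigma\tilde c^{\ell,n}_\sigma D\mu^{\ell,n+1}_{i,\sigma},\quad \ell=1,\dots,M,\ i=1,\dots,N,$$ with $\mu^{\ell,n+1}_i$ the nodal chemical potential at step $n+1$. The mobility is $\tilde c^{\ell,n}_\sigma=c^{\ell,n}_{i\to j}$ if $D\mu^{\ell,n}_{i,\sigma}<0$ and $c^{\ell,n}_{j\to i}$ if $D\mu^{\ell,n}_{i,\sigma}\ge0$. Scheme II: discrete Poisson equation at step $n+1$ together with $$\mathrm{m}(V_i)\frac{c^{\ell,n+1}_i-c^{\ell,n}_i}{\Delta t}=\gamma_\ell\sum_{\sigma\in\mathcal{E}_i}\tau_\sigma\check c^{\ell,n+\frac12}_\sigma D\mu^{\ell,n+\frac12}_{i,\sigma},$$ $$\mu^{\ell,n+\frac12}_i=\mu^{\ell,n+\frac12}_{e1,i}+\mu^{\ell,n+\frac12}_{e2,i}+\frac{z^\ell}{2}(\psi^n_i+\psi^{n+1}_i)+\frac{\chi(z^\ell)^2}{a_\ell}\left(\frac1{\varepsilon_i}-1\right),$$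 $$\mu^{\ell,n+\frac12}_{e1,i}=\log(a_\ell^3c^{\ell,n+1}_i)-\frac{c^{\ell,n+1}_i-c^{\ell,n}_i}{2c^{\ell,n+1}_i}-\frac{(c^{\ell,n+1}_i-c^{\ell,n}_i)^2}{6(c^{\ell,n+1}_i)^2},$$ $$\mu^{\ell,n+\frac12}_{e2,i}=-\frac{a_\ell^3}{a_0^3}\log S^{n+1}_i-\frac{a_\ell^3\sum_{k=1}^M a_k^3(c^{k,n+1}_i-c^{k,n}_i)}{2a_0^3S^{n+1}_i}+\frac{a_\ell^3\left[\sum_{k=1}^M a_k^3(c^{k,n+1}_i-c^{k,n}_i)\right]^2}{6a_0^3(S^{n+1}_i)^2}.$$ The mobility is $\check c^{\ell,n+\frac12}_\sigma=\hat c^{\ell,n+\frac12}_{i\to j}$ if $D\mu^{\ell,n}_{i,\sigma}<0$ and $\hat c^{\ell,n+\frac12}_{j\to i}$ if $D\mu^{\ell,n}_{i,\sigma}\ge0$, where $\hat c^{\ell,n+\frac12}_i=\frac12(3c^{\ell,n}_i-c^{\ell,n-1}_i)$ if $3c^{\ell,n}_i>c^{\ell,n-1}_i$ and $\hat c^{\ell,n+\frac12}_i=(c^{\ell,n}_i)^{3/2}/(c^{\ell,n-1}_i)^{1/2}$ otherwise. For each interior edge $\sigma=\partial V_i\cap\partial V_j$ the mobility is a single number attached to $\sigma$ (a fixed ordering $(i,j)$ of the two volumes is used in its definition). Multislope reconstruction $u\mapsto u_{i\to j}$ (used for $u=c^{\ell,n}$ or $u=\hat c^{\ell,n+\frac12}$):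 choose the neighbour $\mathbf{x}_{k_1}$ of $\mathbf{x}_i$ (vertex whose Voronoi cell touches $V_i$) maximizing the cosine of the angle between $\overrightarrow{\mathbf{x}_q\mathbf{x}_i}$ and $\overrightarrow{\mathbf{x}_i\mathbf{x}_j}$ over neighbours $\mathbf{x}_q$; for $r=0,1,2,\dots$ let $\mathbf{x}^{\rm ext}_{ij}=\frac{(2^r+1)\mathbf{x}_i-\mathbf{x}_j}{2^r}$ and take the first $r$ for which it lies in a Delaunay triangle (tetrahedron) having $\mathbf{x}_{k_1}\mathbf{x}_i$ as an edge; let $u^{\rm ext}_{ij}$ be the interpolated value there from the vertex values. Put $s^+_{ij}=\frac{u_j-u_i}{|\mathbf{x}_i\mathbf{x}_j|}$, $s^-_{ij}=\frac{u_i-u^{\rm ext}_{ij}}{|\mathbf{x}_i\mathbf{x}^{\rm ext}_{ij}|}$ and $u_{i\to j}=u_i+\frac{|\mathbf{x}_i\mathbf{x}_j|}2\,\mathrm{minmod}\left(\beta s^+_{ij},\beta s^-_{ij},\frac{s^+_{ij}+s^-_{ij}}2\right)$ with fixed $\beta\in[1,2]$; $\mathrm{minmod}(q_1,q_2,q_3)=k\min_r|q_r|$ if all $q_r$ have the same sign $k$, and $0$ otherwise. $u_{j\to i}$ is defined by exchanging $i$ and $j$. *)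

(* Defs.v *)
From mathcomp Require Export all_boot all_order all_algebra.
From mathcomp Require Export all_classical all_reals all_analysis.
Export numFieldNormedType.Exports.
Export Order.TTheory GRing.Theory Num.Theory.

Set Implicit Arguments.
Unset Strict Implicit.
Unset Printing Implicit Defensive.

Local Open Scope classical_set_scope.
Local Open Scope ring_scope.

(* The library's norm on 'rV[R]_d is the sup norm; the topology is the same,
   but all lengths below are Euclidean. *)
Section Euclidean.
Variables (R : realType) (d : nat).
Implicit Types (u v : 'rV[R]_d) (A : set 'rV[R]_d).

Definition dot u v : R := \sum_k u 0 k * v 0 k.

Definition enorm u : R := Num.sqrt (dot u u).

Definition cos_angle u v : R := dot u v / (enorm u * enorm v).

Definition boundary A : set 'rV[R]_d := closure A `\` interior A.

Definition dist_set u A : R := inf [set enorm (u - v) | v in A].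

(* [maxe 0] only matters for the empty set. *)
Definition ediam A : \bar R :=
  maxe 0%E (ereal_sup [set (enorm (p.1 - p.2))%:E | p in A `*` A]).

Definition diam A : R := fine (ediam A).

(* [w] are barycentric coordinates of [y] in the simplex whose vertices are
   the [p i], [i \in A]. *)
Definition barycentric (I : finType) (p : I -> 'rV[R]_d) (A : {set I})
    (w : I -> R) (y : 'rV[R]_d) : Prop :=
  [/\ forall i, 0 <= w i,
      forall i, i \notin A -> w i = 0,
      \sum_i w i = 1 &
      y = \sum_i w i *: p i].

Definition hull (I : finType) (p : I -> 'rV[R]_d) (A : {set I}) :
    set 'rV[R]_d :=
  [set y | exists w, barycentric p A w y].

Definition affinely_independent (I : finType) (p : I -> 'rV[R]_d)
    (A : {set I}) : Prop :=
  forall w : I -> R, (forall i, i \notin A -> w i = 0) ->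
    \sum_i w i = 0 -> \sum_i w i *: p i = 0 -> forall i, w i = 0.

(* Triangulable: the interior of a finite union of closed, nondegenerate
   d-simplices (hence open and bounded). *)
Definition polyhedral_domain A : Prop :=
  [/\ A !=set0, connected A &
      exists (K : nat) (t : 'I_K -> 'I_d.+1 -> 'rV[R]_d),
        (forall k, affinely_independent (t k) [set: 'I_d.+1]%SET) /\
        A = interior (\bigcup_(k in [set: 'I_K]) hull (t k) [set: 'I_d.+1]%SET)].

End Euclidean.

(* Lebesgue measure on 'rV[R]_n as the iterated product of [lebesgue_measure];
   the successor case unfolds [product_measure1] along
   'rV_(1 + n) = R x 'rV_n. *)
Fixpoint leb (R : realType) (n : nat) : set 'rV[R]_n -> \bar R :=
  match n return set 'rV[R]_n -> \bar R with
  | 0 => fun A => (\1_A (0 : 'rV[R]_0))%:E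
  | n'.+1 => fun A =>
      (\int[@lebesgue_measure R]_(t in [set: R])
         leb [set v : 'rV[R]_n' | A (row_mx (t%:M : 'rV[R]_1) v)])%E
  end.

Section Hausdorff.
Variables (R : realType) (d : nat).

(* Volume of the k-dimensional Euclidean ball of diameter 1: with this constant
   the k-dimensional Hausdorff measure is the k-dimensional Lebesgue measure on
   k-planes. *)
Definition ball_const (k : nat) : R :=
  fine (leb [set v : 'rV[R]_k | enorm v <= 2^-1]).

Definition hausdorff_pre (k : nat) (delta : R) (A : set 'rV[R]_d) : \bar R :=
  ereal_inf
    [set (\sum_(0 <= m <oo) (ball_const k * diam (E m) ^+ k)%:E)%E
       | E in [set E : (set 'rV[R]_d)^nat |
                 A `<=` \bigcup_m E m /\
                 forall m, (ediam (E m) <= delta%:E)%E]].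

Definition hausdorff (k : nat) (A : set 'rV[R]_d) : \bar R :=
  ereal_sup [set hausdorff_pre k delta A | delta in [set delta | 0 < delta]].

Definition surf (A : set 'rV[R]_d) : \bar R := hausdorff d.-1 A.

End Hausdorff.

(* An edge seen from [V_i]: [inl j] is the common edge of [V_i] and [V_j],
   [inr true] and [inr false] are the parts of the boundary of [V_i] on
   [Gamma_D] and [Gamma_N]. *)
Notation edge_label N := ('I_N + bool)%type.

Section Cells.
Variables (R : realType) (d N : nat).
Variables (Omega GammaD GammaN : set 'rV[R]_d) (x : 'I_N -> 'rV[R]_d).

Definition voronoi_cell (i : 'I_N) : set 'rV[R]_d :=
  [set y | Omega y /\
           forall j, j != i -> enorm (x i - y) < enorm (x j - y)].

Definition edge_set (i : 'I_N) (e : edge_label N) : set 'rV[R]_d :=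
  match e with
  | inl j => boundary (voronoi_cell i) `&` boundary (voronoi_cell j)
  | inr b => boundary (voronoi_cell i) `&` (if b then GammaD else GammaN)
  end.

(* Contacts of zero (d-1)-measure are not edges. *)
Definition edge_of (i : 'I_N) (e : edge_label N) : bool :=
  (e != inl i) && (0 < surf (edge_set i e))%E.

End Cells.

Section Delaunay.
Variables (R : realType) (d N : nat).

(* The simplices are not asked to cover [closure Omega]: [xi_regular] keeps
   every vertex away from the exterior edges of its own cell, so no mesh with
   vertices at the corners of [Omega] would satisfy it. *)
Record delaunay_mesh := DelaunayMesh {
  Omega : set 'rV[R]_d;
  GammaD : set 'rV[R]_d;
  GammaN : set 'rV[R]_d;
  x : 'I_N -> 'rV[R]_d;
  simplices : {set {set 'I_N}};
  xi : R;
  Omega_polyhedral : polyhedral_domain Omega;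
  boundary_split : boundary Omega = GammaD `|` GammaN;
  boundary_disjoint : GammaD `&` GammaN = set0;
  x_inj : injective x;
  x_in : forall i, closure Omega (x i);
  vertex_used : forall i, exists2 T, T \in simplices & i \in T;
  simplex_card : forall T, T \in simplices -> #|T| = d.+1;
  simplex_nondegenerate : forall T, T \in simplices ->
    affinely_independent x T;
  conforming : forall T T', T \in simplices -> T' \in simplices ->
    hull x T `&` hull x T' = hull x (T :&: T')%SET;
  empty_circumsphere : forall T, T \in simplices ->
    exists (o : 'rV[R]_d) (r : R),
      (forall i, i \in T -> enorm (x i - o) = r) /\
      (forall j, r <= enorm (x j - o));
  xi_gt0 : 0 < xi;
  xi_regular : forall i e, edge_of Omega GammaD GammaN x i e ->
    xi * diam (voronoi_cell Omega x i)
      <= dist_set (x i) (edge_set Omega GammaD GammaN x i e)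
}.

End Delaunay.

Section MeshGeometry.
Variables (R : realType) (d N : nat) (X : delaunay_mesh R d N).
Implicit Types (i j k q : 'I_N) (e : edge_label N).

Definition cell i : set 'rV[R]_d := voronoi_cell (Omega X) (x X) i.

Definition face i e : set 'rV[R]_d :=
  edge_set (Omega X) (GammaD X) (GammaN X) (x X) i e.

Definition is_edge i e : bool :=
  edge_of (Omega X) (GammaD X) (GammaN X) (x X) i e.

Definition vol i : R := fine (leb (cell i)).

Definition d_edge i e : R :=
  match e with
  | inl j => enorm (x X i - x X j)
  | inr _ => dist_set (x X i) (face i e)
  end.

Definition tau i e : R := fine (surf (face i e)) / d_edge i e.

Definition neighbour i q : Prop :=
  q != i /\ (closure (cell i) `&` closure (cell q)) !=set0.

Definition upstream i j k : Prop :=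
  neighbour i k /\
  forall q, neighbour i q ->
    cos_angle (x X i - x X q) (x X j - x X i)
      <= cos_angle (x X i - x X k) (x X j - x X i).

Definition ext_point i j (r : nat) : 'rV[R]_d :=
  (2 ^+ r)^-1 *: ((2 ^+ r + 1) *: x X i - x X j).

Definition ext_in i j k (r : nat) (T : {set 'I_N}) (w : 'I_N -> R) : Prop :=
  [/\ T \in simplices X, k \in T, i \in T &
      barycentric (x X) T w (ext_point i j r)].

Definition ext_first i j k (r : nat) : Prop :=
  (exists T w, ext_in i j k r T w) /\
  forall r', (r' < r)%N -> ~ exists T w, ext_in i j k r' T w.

Definition minmod (q1 q2 q3 : R) : R :=
  let m := Num.min `|q1| (Num.min `|q2| `|q3|) in
  if [&& 0 < q1, 0 < q2 & 0 < q3] then m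
  else if [&& q1 < 0, q2 < 0 & q3 < 0] then - m
  else 0.

(* [up] resolves ties in the choice of x_{k_1}.  When no r is admissible (for
   instance when x_i is an extreme point of the set of all vertices) the
   extrapolated value does not exist and the slope s^- is left arbitrary. *)
Record multislope := Multislope {
  beta : R;
  up : 'I_N -> 'I_N -> 'I_N;
  back_slope : ('I_N -> R) -> 'I_N -> 'I_N -> R;
  beta_range : 1 <= beta <= 2;
  up_upstream : forall i j, is_edge i (inl j) -> upstream i j (up i j);
  back_slopeE : forall (u : 'I_N -> R) i j (r : nat) T w,
    is_edge i (inl j) ->
    ext_first i j (up i j) r -> ext_in i j (up i j) r T w ->
    back_slope u i j
      = (u i - \sum_k w k * u k) / enorm (x X i - ext_point i j r)
}.

(* u_{i -> j} *)
Definition reconstruct (S : multislope) (u : 'I_N -> R) i j : R :=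
  let h := enorm (x X i - x X j) in
  let sp := (u j - u i) / h in
  let sm := back_slope S u i j in
  u i + h / 2 * minmod (beta S * sp) (beta S * sm) ((sp + sm) / 2).

End MeshGeometry.

Section Schemes.
Variables (R : realType) (d N M : nat) (X : delaunay_mesh R d N).

Record parameters := MkParameters {
  z : 'I_M -> R;
  a : 'I_M -> R;
  a0 : R;
  kappa : R;
  chi : R;
  gamma : 'I_M -> R;
  eps_min : R;
  eps_max : R;
  eps : 'I_N -> R;
  eps_edge : set 'rV[R]_d -> R;
  rhof : 'I_N -> R;
  psiD : set 'rV[R]_d -> R;
  psiN : set 'rV[R]_d -> R;
  dt : R;
  slopes : multislope X;
  (* [orient i j]: the edge between V_i and V_j is ordered as (i, j) *)
  orient : rel 'I_N;
  a_gt0 : forall l, 0 < a l;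
  a0_gt0 : 0 < a0;
  kappa_gt0 : 0 < kappa;
  chi_gt0 : 0 < chi;
  gamma_gt0 : forall l, 0 < gamma l;
  eps_min_gt0 : 0 < eps_min;
  eps_range : forall i, eps_min <= eps i <= eps_max;
  eps_edge_range : forall i e, is_edge X i e ->
    eps_min <= eps_edge (face X i e) <= eps_max;
  dt_gt0 : 0 < dt;
  orientP : forall i j, i != j -> orient i j = ~~ orient j i
}.

Variable P : parameters.
Implicit Types (c : 'I_M -> 'I_N -> R) (psi : 'I_N -> R).
Implicit Types (l : 'I_M) (i j : 'I_N) (e : edge_label N).

Definition solvent c i : R := 1 - \sum_k a P k ^+ 3 * c k i.

(* Domain of the logarithms in the chemical potentials ([ln] is total). *)
Definition log_domain c : Prop :=
  (forall l i, 0 < c l i) /\ (forall i, 0 < solvent c i).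

Definition born l i : R := chi P * z P l ^+ 2 / a P l * ((eps P i)^-1 - 1).

Definition mu c psi l i : R :=
  z P l * psi i + ln (a P l ^+ 3 * c l i)
  - a P l ^+ 3 / a0 P ^+ 3 * ln (solvent c i) + born l i.

Definition poisson c psi : Prop :=
  exists Dpsi : 'I_N -> edge_label N -> R,
    [/\ forall i j, is_edge X i (inl j) -> Dpsi i (inl j) = psi j - psi i,
        forall i, is_edge X i (inr true) ->
          Dpsi i (inr true) = psiD P (face X i (inr true)) - psi i,
        forall i, is_edge X i (inr false) ->
          kappa P * eps_edge P (face X i (inr false)) * Dpsi i (inr false)
            / d_edge X i (inr false) = psiN P (face X i (inr false)) &
        forall i,
          - kappa P * \sum_(e | is_edge X i e)
                        tau X i e * eps_edge P (face X i e) * Dpsi i e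
          = vol X i * (\sum_l z P l * c l i + rhof P i)].

(* The number attached to the interior edge between V_i and V_j: [nu] is the
   potential deciding the direction, [u] the density being reconstructed. *)
Definition mobility (nu u : 'I_N -> R) i j : R :=
  let: (p, q) := if orient P i j then (i, j) else (j, i) in
  if nu q - nu p < 0 then reconstruct (slopes P) u p q
  else reconstruct (slopes P) u q p.

(* The discrete Nernst-Planck equation of species [l], with interior
   mobilities [mob], driving potential [nu] and zero flux on exterior edges. *)
Definition nernst_planck l (mob : 'I_N -> 'I_N -> R) (nu : 'I_N -> R)
    (cl cl' : 'I_N -> R) : Prop :=
  exists (m Dnu : 'I_N -> edge_label N -> R),
    [/\ forall i j, is_edge X i (inl j) -> m i (inl j) = mob i j,
        forall i j, is_edge X i (inl j) -> Dnu i (inl j) = nu j - nu i,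
        forall i b, is_edge X i (inr b) -> m i (inr b) * Dnu i (inr b) = 0 &
        forall i,
          vol X i * ((cl' i - cl i) / dt P)
          = gamma P l * \sum_(e | is_edge X i e) tau X i e * m i e * Dnu i e].

(* [cm], [c], [c'] are the densities at steps n-1, n, n+1. *)

Definition schemeI c psi c' psi' : Prop :=
  [/\ log_domain c, log_domain c', poisson c' psi' &
      forall l,
        nernst_planck l (mobility (mu c psi l) (c l)) (mu c' psi' l)
                      (c l) (c' l)].

Definition chat cm c l i : R :=
  if cm l i < 3 * c l i then (3 * c l i - cm l i) / 2
  else c l i `^ (3 / 2) / cm l i `^ (1 / 2).

Definition mu_e1 c c' l i : R :=
  ln (a P l ^+ 3 * c' l i) - (c' l i - c l i) / (2 * c' l i)
  - (c' l i - c l i) ^+ 2 / (6 * c' l i ^+ 2).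

Definition mu_e2 c c' l i : R :=
  let D := \sum_k a P k ^+ 3 * (c' k i - c k i) in
  - (a P l ^+ 3 / a0 P ^+ 3) * ln (solvent c' i)
  - a P l ^+ 3 * D / (2 * a0 P ^+ 3 * solvent c' i)
  + a P l ^+ 3 * D ^+ 2 / (6 * a0 P ^+ 3 * solvent c' i ^+ 2).

Definition mu_half c psi c' psi' l i : R :=
  mu_e1 c c' l i + mu_e2 c c' l i + z P l / 2 * (psi i + psi' i) + born l i.

Definition schemeII cm c psi c' psi' : Prop :=
  [/\ log_domain c, log_domain c', poisson c' psi' &
      forall l,
        nernst_planck l (mobility (mu c psi l) (chat cm c l))
                      (mu_half c psi c' psi' l) (c l) (c' l)].

End Schemes.

(* Main.v *)
Require Import Defs.

Local Open Scope ring_scope.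

(** Both schemes are finite-volume schemes in conservative form, and this is
    all that mass conservation uses.  Summing the update over the control
    volumes leaves the sum, over all pairs of a volume and one of its edges, of
    the fluxes [tau * mobility * Dmu].  Exterior edges contribute nothing by
    the zero-flux condition.  An interior edge is visited twice, once from
    either side; its transmissibility ([tau_sym]) and its mobility
    ([mobility_sym]) do not depend on the side, whereas the difference of the
    potential changes sign, so the two visits cancel ([sum_antisym]).

    The argument, [nernst_planck_mass], holds for an arbitrary driving
    potential and an arbitrary reconstructed density, so the schemes differ
    only in what they substitute for these. *)

(** The sum is its own opposite, as exchanging the two indices shows. *)
Lemma sum_antisym (R : numDomainType) (I : finType) (r : rel I)
    (G : I -> I -> R) :
  symmetric r -> (forall i j, r i j -> G j i = - G i j) ->
  \sum_i \sum_(j | r i j) G i j = 0.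
Proof.
move=> r_sym GN; set s := LHS.
suff sN : s = - s by apply/eqP; rewrite -eqNr -sN.
rewrite {1}/s (exchange_big_dep predT) //= /s -sumrN.
apply: eq_bigr => i _; rewrite -sumrN.
by apply: eq_big => [j|j rji]; rewrite 1?r_sym // GN // r_sym.
Qed.

Lemma enorm_subC (R : realType) (d : nat) (u v : 'rV[R]_d) :
  enorm (u - v) = enorm (v - u).
Proof.
rewrite /enorm /dot; congr Num.sqrt; apply: eq_bigr => k _.
by rewrite -opprB mxE mulrNN.
Qed.

Section InteriorEdges.
Variables (R : realType) (d N : nat) (X : delaunay_mesh R d N).
Implicit Types i j : 'I_N.

Lemma face_sym i j : face X i (inl j) = face X j (inl i).
Proof. exact: setIC. Qed.

Lemma is_edge_sym i j : is_edge X i (inl j) = is_edge X j (inl i).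
Proof.
rewrite /is_edge /edge_of -!/(face X _ _) face_sym.
by congr (_ && _); rewrite !(inj_eq inl_inj) eq_sym.
Qed.

Lemma is_edge_neq i j : is_edge X i (inl j) -> i != j.
Proof. by case/andP; rewrite (inj_eq inl_inj) eq_sym. Qed.

Lemma tau_sym i j : tau X i (inl j) = tau X j (inl i).
Proof. by rewrite /tau face_sym /= enorm_subC. Qed.

End InteriorEdges.

Arguments is_edge_neq {R d N X i j}.

Section Conservation.
Variables (R : realType) (d N M : nat) (X : delaunay_mesh R d N).
Variable P : parameters M X.

(** The upwind direction and both one-sided reconstructions are read off the
    fixed ordering of the two volumes, which is the same from either side. *)
Lemma mobility_sym (nu u : 'I_N -> R) (i j : 'I_N) :
  i != j -> mobility P nu u i j = mobility P nu u j i.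
Proof. by move=> ij; rewrite /mobility (orientP P ij); case: (orient P j i). Qed.

Lemma nernst_planck_mass (l : 'I_M) (nu u : 'I_N -> R)
    (drive cl cl' : 'I_N -> R) :
  nernst_planck P l (mobility P nu u) drive cl cl' ->
  \sum_(i < N) vol X i * cl' i = \sum_(i < N) vol X i * cl i.
Proof.
move=> [m [D [mE DE flux0 update]]].
have total_flux0 :
    \sum_i \sum_(e | is_edge X i e) tau X i e * m i e * D i e = 0.
  under eq_bigr => i _.
    rewrite big_sumType /= [X in _ + X]big1 ?addr0; last first.
      by move=> b ib; rewrite -mulrA flux0 ?mulr0.
    over.
  apply: (sum_antisym _ _ (fun i j => is_edge X i (inl j))) => [i j|i j ij].
    exact: is_edge_sym.
  have ji : is_edge X j (inl i) by rewrite is_edge_sym.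
  rewrite !mE // !DE // tau_sym (mobility_sym nu u j i (is_edge_neq ji)).
  by rewrite -mulrN opprB.
apply/eqP; rewrite -subr_eq0 -sumrB.
have -> : \sum_i (vol X i * cl' i - vol X i * cl i)
    = dt P * \sum_i vol X i * ((cl' i - cl i) / dt P).
  rewrite mulr_sumr; apply: eq_bigr => i _.
  by rewrite -mulrBr mulrCA [dt P * _]mulrC divfK // gt_eqF // dt_gt0.
under eq_bigr => i _ do rewrite update.
by rewrite -mulr_sumr total_flux0 !mulr0.
Qed.

End Conservation.

Theorem theorem4p1 (R : realType) (d N M : nat) (hd : d = 2%N \/ d = 3%N)
    (X : delaunay_mesh R d N) (P : parameters M X)
    (cm c c' : 'I_M -> 'I_N -> R) (psi psi' : 'I_N -> R) :
  (schemeI P c psi c' psi' ->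
     forall l : 'I_M,
       \sum_(i < N) vol X i * c' l i = \sum_(i < N) vol X i * c l i)
  /\
  (schemeII P cm c psi c' psi' ->
     forall l : 'I_M,
       \sum_(i < N) vol X i * c' l i = \sum_(i < N) vol X i * c l i).
Proof.
by split=> -[_ _ _ np] l; apply: nernst_planck_mass (np l).
Qed.
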